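(* For every positive integer $n$, $$\sum_{w \in CW_n} q^{\operatorname{maj}(w) - \operatorname{maj}(w^{-1})} \;=\; \sum_{\sigma \in S_n(123)} q^{2(\operatorname{maj}(\sigma) - \operatorname{maj}(\sigma^{-1}))}.$$
   Context: $CW_n$ is the set of Catalan words of length $2n$: words $x_1\cdots x_{2n}$ with each $x_i\in\{0,1\}$, containing exactly $n$ ones, such that no initial segment $x_1\cdots x_m$ contains more 1s than 0s. For a $0/1$ word $w=x_1\cdots x_m$, its descent set is $\mathrm{Des}(w)=\{i : x_i=1,\ x_{i+1}=0\}$ and $\operatorname{maj}(w)=\sum_{i\in \mathrm{Des}(w)} i$. The inverse $w^{-1}$ of a $0/1$ word is obtained by reversing $w$ and exchanging 0 and 1 (i.e. $w^{-1}=y_1\cdots y_m$ with $y_k=1-x_{m+1-k}$). $S_n(123)$ is the set of permutations of $\{1,\dots,n\}$ whose longest increasing subsequence has length at most 2. For a permutation $\sigma$ (in one-line notation), $\operatorname{maj}(\sigma)$ is the sum of the positions $i$ with $\sigma(i)>\sigma(i+1)$, and $\sigma^{-1}$ is the inverse permutation. *)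

(* Defs.v *)
From mathcomp Require Import all_boot all_order all_fingroup all_algebra.

Set Implicit Arguments.
Unset Strict Implicit.
Unset Printing Implicit Defensive.

(* A 0/1 word is a [seq bool], with [true] for the letter 1.  Positions in    *)
(* words and permutations are counted from 1 in the descent sums below,       *)
(* whereas [nth] counts from 0: the letter x_i is [nth _ w i.-1].             *)

Definition is_catalan (n : nat) (w : seq bool) : bool :=
  [&& size w == n.*2, count_mem true w == n &
      [forall m : 'I_(n.*2).+1,
         count_mem true (take m w) <= count_mem false (take m w)]].

Definition word_inv (w : seq bool) : seq bool := rev (map negb w).

Definition maj_word (w : seq bool) : nat :=
  \sum_(1 <= i < size w | nth false w i.-1 && ~~ nth false w i) i.

(* Permutations of {1, ..., n} are elements of 'S_n, acting on {0, ..., n-1}. *)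
Definition one_line (n : nat) (s : 'S_n) : seq nat :=
  [seq (val (s i)).+1 | i <- enum 'I_n].

Definition maj_perm (n : nat) (s : 'S_n) : nat :=
  \sum_(1 <= i < n | nth 0 (one_line s) i.-1 > nth 0 (one_line s) i) i.

(* An increasing subsequence is given by its set of positions. *)
Definition increasing_on (n : nat) (s : 'S_n) (A : {set 'I_n}) : bool :=
  [forall i in A, forall j in A, (i < j) ==> (s i < s j)].

Definition lis (n : nat) (s : 'S_n) : nat :=
  \max_(A : {set 'I_n} | increasing_on s A) #|A|.

Definition avoids123 (n : nat) (s : 'S_n) : bool := lis s <= 2.

(* Main.v *)
Require Import Defs.
From mathcomp Require Import all_boot all_order all_fingroup all_algebra.
From mathcomp Require Import zify ring.

Set Implicit Arguments.
Unset Strict Implicit.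
Unset Printing Implicit Defensive.

Import GRing.Theory.
Local Open Scope ring_scope.

(** Call a word suffix-ballot if all its suffixes, prefix-ballot if all its
    prefixes, have at most as many 1s as 0s.  Cutting a Catalan word of length
    2n at its midpoint gives two suffix-ballot words r, s of length n with the
    same number of 1s, and maj(w) - maj(w^-1) = 2 (maj r - maj s).
    The Robinson-Schensted correspondence, restricted to permutations avoiding
    123, gives a suffix-ballot word r (the insertion tableau) and a
    prefix-ballot word v (the recording tableau) with the same number of 1s; it
    turns inverse descents and descents into pattern occurrences in r and v, so
    that maj(sigma) - maj(sigma^-1) = maj r - maj v', where v' is the
    complement of v.  The two sums agree because maj r and maj v' have the same
    distribution on words with a given number of 1s: both generating functions
    are the difference of two Gaussian binomials. *)

(** * Ballot words and the major index *)

Lemma sum_seq_bij (V : nmodType) (I J : eqType) (s : seq I) (t : seq J)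
    (P : pred I) (Q : pred J) (f : I -> J) (g : J -> I) (F : J -> V) :
  uniq s -> uniq t ->
  (forall i, i \in s -> P i -> [/\ f i \in t, Q (f i) & g (f i) = i]) ->
  (forall j, j \in t -> Q j -> [/\ g j \in s, P (g j) & f (g j) = j]) ->
  \sum_(i <- s | P i) F (f i) = \sum_(j <- t | Q j) F j.
Proof.
move=> Us Ut Hf Hg; rewrite -big_filter -[RHS]big_filter -(big_map f xpredT F).
apply: perm_big; apply: uniq_perm; last 1 first.
- move=> j; rewrite mem_filter; apply/mapP/andP => [[i]|[Qj tj]].
    by rewrite mem_filter => /andP[Pi si] ->; have [? ? _] := Hf _ si Pi.
  by have [? Pg fg] := Hg _ tj Qj; exists (g j); rewrite // mem_filter Pg.
- rewrite map_inj_in_uniq ?filter_uniq // => i i'.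
  rewrite !mem_filter => /andP[Pi si] /andP[Pi' si'] e.
  by have [_ _ <-] := Hf _ si Pi; have [_ _ <-] := Hf _ si' Pi'; rewrite e.
- exact: filter_uniq.
Qed.

(** Words grow at the right end because appending a letter changes [maj_word] only by a possible
    descent at the old length. *)
Fixpoint words (n : nat) : seq (seq bool) :=
  if n is m.+1 then [seq rcons w b | w <- words m, b <- [:: false; true]]
  else [:: [::]].

Arguments words : simpl never.

Lemma wordsS n :
  words n.+1 = [seq rcons w b | w <- words n, b <- [:: false; true]].
Proof. by []. Qed.

Lemma mem_words n w : (w \in words n) = (size w == n).
Proof.
elim: n w => [|n IH] w; first by case: w.
rewrite wordsS.
case/lastP: w => [|w b].
  apply: negbTE; apply/negP => /allpairsP[[w b] /= [_ _]] /(congr1 size).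
  by rewrite size_rcons.
rewrite size_rcons eqSS -IH; apply/allpairsP/idP => [[[w' b'] /= [Hw _]]|Hw].
  by case/rcons_inj=> -> _.
by exists (w, b); split => //; case: b.
Qed.

Lemma words_uniq n : uniq (words n).
Proof.
elim: n => // n IH; rewrite wordsS.
apply: allpairs_uniq => // -[w b] [w' b'] _ _ /=.
by case/rcons_inj=> -> ->.
Qed.

Lemma sum_words_rcons (V : nmodType) n (F : seq bool -> V) :
  \sum_(w <- words n.+1) F w
  = \sum_(w <- words n) (F (rcons w false) + F (rcons w true)).
Proof.
rewrite wordsS big_allpairs_dep; apply: eq_bigr => w _.
by rewrite big_cons big_seq1.
Qed.

(* [pb h w]: every prefix of [w] has at most [h] more 1s than 0s; [sb h w] says
   the same of the suffixes. *)
Fixpoint pb (h : nat) (w : seq bool) : bool :=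
  if w is b :: t then if b then (0 < h)%N && pb h.-1 t else pb h.+1 t
  else true.

Definition ones (w : seq bool) : nat := count_mem true w.
Definition zeros (w : seq bool) : nat := count_mem false w.
Arguments ones : simpl never.
Arguments zeros : simpl never.

Lemma ones_cons b w : ones (b :: w) = (b + ones w)%N.
Proof. by case: b. Qed.

Lemma zeros_cons b w : zeros (b :: w) = (~~ b + zeros w)%N.
Proof. by case: b. Qed.

Lemma ones_cat u w : ones (u ++ w) = (ones u + ones w)%N.
Proof. exact: count_cat. Qed.

Lemma zeros_cat u w : zeros (u ++ w) = (zeros u + zeros w)%N.
Proof. exact: count_cat. Qed.

Lemma ones_rcons w b : ones (rcons w b) = (ones w + b)%N.
Proof. by rewrite -cats1 ones_cat ones_cons addn0. Qed.

Lemma ones_rev w : ones (rev w) = ones w.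
Proof. exact: count_rev. Qed.

Lemma zeros_rev w : zeros (rev w) = zeros w.
Proof. exact: count_rev. Qed.

Lemma ones_negb w : ones (map negb w) = zeros w.
Proof. by elim: w => //= b w; rewrite ones_cons zeros_cons => ->. Qed.

Lemma zeros_negb w : zeros (map negb w) = ones w.
Proof. by elim: w => //= b w; rewrite ones_cons zeros_cons negbK => ->. Qed.

Definition sb (h : nat) (w : seq bool) : bool := pb h (rev w).

Lemma ones_zeros w : (ones w + zeros w)%N = size w.
Proof.
by elim: w => //= b w; rewrite ones_cons zeros_cons; case: b => /=; lia.
Qed.

Lemma pb_cat h u w :
  pb h (u ++ w) = pb h u && pb (h + zeros u - ones u) w.
Proof.
elim: u h => [|b u IH] h /=; first by rewrite addn0 subn0.
rewrite ones_cons zeros_cons; case: b => /=.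
  case: h => //= h; rewrite IH; congr (_ && pb _ _); lia.
rewrite IH; congr (_ && pb _ _); lia.
Qed.

Lemma pb_count h w : pb h w -> (ones w <= h + zeros w)%N.
Proof.
elim: w h => // b w IH h /=; rewrite ones_cons zeros_cons.
by case: b => /= [/andP[h0]|] /IH; lia.
Qed.

Lemma pb_rcons h w b : pb h (rcons w b)
  = pb h w && (b ==> (ones w < h + zeros w)%N).
Proof.
rewrite -cats1 pb_cat; case: (boolP (pb h w)) => //= /pb_count Hc.
by case: b => //=; rewrite andbT; lia.
Qed.

Lemma pbP h w :
  reflect (forall m, (ones (take m w) <= h + zeros (take m w))%N) (pb h w).
Proof.
apply: (iffP idP) => [Hw m|].
  apply: pb_count; move: Hw.
  by rewrite -{1}(cat_take_drop m w) pb_cat => /andP[].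
elim: w h => //= -[] w IH h H.
  have := H 1%N; rewrite /= take0 ones_cons zeros_cons /= => h0.
  apply/andP; split; first by move: h0; rewrite /ones /zeros /=; lia.
  apply: IH => m; have := H m.+1; rewrite /= ones_cons zeros_cons /=.
  by move: h0; rewrite /ones /zeros /=; lia.
by apply: IH => m; have := H m.+1; rewrite /= ones_cons zeros_cons /=; lia.
Qed.

(** The weight is arbitrary so as to serve both [maj_word] and [des_word]; the default in
    [last false] rules out a descent after the empty word. *)
Lemma sum_pair_rcons (F : nat -> nat) w b :
  (\sum_(1 <= i < size (rcons w b)
     | nth false (rcons w b) i.-1 && ~~ nth false (rcons w b) i) F i
   = \sum_(1 <= i < size w | nth false w i.-1 && ~~ nth false w i) F i
     + (last false w && ~~ b) * F (size w))%N.
Proof.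
rewrite size_rcons; case/lastP: w => [|w c]; first by rewrite !big_geq.
rewrite size_rcons big_mkcond big_nat_recr //= -big_mkcond /= last_rcons.
congr (_ + _)%N.
  rewrite big_nat_cond [RHS]big_nat_cond; apply: eq_bigl => i.
  case: (boolP (0 < i < (size w).+1)%N) => //= /andP[i0 iw].
  by congr (_ && ~~ _); rewrite [LHS]nth_rcons size_rcons ifT //; lia.
rewrite !nth_rcons !size_rcons ltnS leqnn ltnn eqxx ltnn eqxx.
by case: (c && ~~ b); rewrite ?mul1n.
Qed.

Lemma maj_word_nil : maj_word [::] = 0%N.
Proof. by rewrite /maj_word big_geq. Qed.

Lemma maj_word_rcons w b :
  maj_word (rcons w b) = (maj_word w + (last false w && ~~ b) * size w)%N.
Proof. exact: sum_pair_rcons. Qed.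

Definition des_word (w : seq bool) : nat :=
  \sum_(1 <= i < size w | nth false w i.-1 && ~~ nth false w i) 1.

Lemma des_word_nil : des_word [::] = 0%N.
Proof. by rewrite /des_word big_geq. Qed.

Lemma des_word_rcons w b :
  des_word (rcons w b) = (des_word w + (last false w && ~~ b))%N.
Proof. by rewrite /des_word (sum_pair_rcons (fun=> 1%N)) muln1. Qed.

(** The two defaults make this 0 when either word is empty. *)
Definition junction (u w : seq bool) : nat := last false u && ~~ head true w.

Lemma maj_word_cat u w : maj_word (u ++ w)
  = (maj_word u + size u * junction u w + size u * des_word w + maj_word w)%N.
Proof.
elim/last_ind: w => [|w b IH].
  by rewrite cats0 maj_word_nil des_word_nil /junction andbF; lia.
rewrite -rcons_cat !maj_word_rcons IH des_word_rcons last_cat size_cat /junction.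
case: w {IH} => [|c w] /=; last by lia.
by rewrite maj_word_nil des_word_nil; case: (last false u); case: b; lia.
Qed.

Lemma des_word_cat u w : des_word (u ++ w)
  = (des_word u + junction u w + des_word w)%N.
Proof.
elim/last_ind: w => [|w b IH].
  by rewrite cats0 /junction des_word_nil andbF; lia.
rewrite -rcons_cat !des_word_rcons IH last_cat /junction.
case: w {IH} => [|c w] /=; last by lia.
by rewrite des_word_nil; case: (last false u); case: b; lia.
Qed.

Lemma maj_word1 b : maj_word [:: b] = 0%N.
Proof. by rewrite /maj_word big_geq. Qed.

Lemma des_word1 b : des_word [:: b] = 0%N.
Proof. by rewrite /des_word big_geq. Qed.

Lemma word_inv_rcons w b : word_inv (rcons w b) = ~~ b :: word_inv w.
Proof. by rewrite /word_inv map_rcons rev_rcons. Qed.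

Lemma word_inv_cat u w : word_inv (u ++ w) = word_inv w ++ word_inv u.
Proof. by rewrite /word_inv map_cat rev_cat. Qed.

Lemma size_word_inv w : size (word_inv w) = size w.
Proof. by rewrite size_rev size_map. Qed.

Lemma head_word_inv w : head true (word_inv w) = ~~ last false w.
Proof. by case/lastP: w => // w b; rewrite word_inv_rcons last_rcons. Qed.

Lemma last_word_inv w : last false (word_inv w) = ~~ head true w.
Proof. by case: w => //= b w; rewrite /word_inv /= rev_cons last_rcons. Qed.

Lemma junction_word_inv u w :
  junction (word_inv w) (word_inv u) = junction u w.
Proof. by rewrite /junction head_word_inv last_word_inv negbK andbC. Qed.

Lemma des_word_inv w : des_word (word_inv w) = des_word w.
Proof.
elim/last_ind: w => // w b IH.
rewrite -cats1 word_inv_cat !des_word_cat IH junction_word_inv.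
by rewrite (word_inv_rcons [::]) !des_word1; lia.
Qed.

(** A descent of [w] at position i becomes a descent of [word_inv w] at [size w - i], so each one
    contributes [size w] in total. *)
Lemma maj_add_word_inv w :
  (maj_word w + maj_word (word_inv w))%N = (size w * des_word w)%N.
Proof.
elim/last_ind: w => [|w b IH]; first by rewrite !maj_word_nil.
rewrite -cats1 word_inv_cat !maj_word_cat des_word_cat junction_word_inv.
rewrite des_word_inv size_cat size_word_inv /=.
rewrite (word_inv_rcons [::]) !maj_word1 des_word1.
by lia.
Qed.

(** For halves of equal length a descent at the seam weighs the same in both words and cancels, and
    [maj_add_word_inv] cancels the [des_word] terms. Subtractions are moved across to stay in
    [nat]. *)
Lemma maj_cat_word_inv u w : size u = size w ->
  (maj_word (u ++ w) + 2 * maj_word (word_inv u)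
   = maj_word (word_inv (u ++ w)) + 2 * maj_word w)%N.
Proof.
move=> e; have := maj_add_word_inv u; have := maj_add_word_inv w.
rewrite word_inv_cat !maj_word_cat junction_word_inv !des_word_inv.
by rewrite size_word_inv e; lia.
Qed.

(** Each maximal block of 1s ends at a descent of [w] or at the end of [w], and begins just after a
    descent of the complement or at the start. End minus beginning, summed over the blocks, is
    [ones w]. *)
Lemma maj_word_negb w :
  (maj_word w + last false w * size w
   = maj_word (map negb w) + ones w)%N.
Proof.
elim/last_ind: w => [|w b IH]; first by rewrite !maj_word_nil.
rewrite map_rcons !maj_word_rcons last_rcons size_rcons size_map.
rewrite ones_rcons.
case: w IH => [|c w]; first by rewrite !maj_word_nil; case: b.
by rewrite [map _ _]/= /= last_map; case: (last c w); case: b => /=; lia.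
Qed.

Lemma sb_last w : sb 0 w -> last false w = false.
Proof. by case/lastP: w => // w b; rewrite /sb rev_rcons last_rcons; case: b. Qed.

Lemma maj_word_sb w : sb 0 w ->
  maj_word w = (maj_word (map negb w) + ones w)%N.
Proof. by move=> /sb_last e; rewrite -maj_word_negb e addn0. Qed.

(** * Generating functions of ballot words *)

(* Gaussian binomials in [x], through the three-term recursion in [n] that
   splitting words by their last letter produces; [gauss2 x n k] is the pair of
   the values at [n] and [n.+1]. *)
Fixpoint gauss2 (R : comNzRingType) (x : R) (n k : nat) : R * R :=
  if n is m.+1 then
    let: g := gauss2 x m in
    ((g k).2, if k is j.+1 then (g j).2 + (g k).2 + (x ^+ n - 1) * (g j).1
              else 1)
  else ((k == 0%N)%:R, (k <= 1)%:R).

Definition gauss (R : comNzRingType) (x : R) (n k : nat) : R := (gauss2 x n k).1.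

Section Gauss.
Variables (R : comNzRingType) (x : R).
Local Notation T := (gauss x).

Lemma gauss0 k : T 0 k = (k == 0%N)%:R. Proof. by []. Qed.
Lemma gauss1 k : T 1 k = (k <= 1)%:R. Proof. by []. Qed.

Lemma gaussn0 n : T n 0 = 1.
Proof. by case: n => // -[]. Qed.

Lemma gaussSS n k :
  T n.+2 k.+1 = T n.+1 k + T n.+1 k.+1 + (x ^+ n.+1 - 1) * T n k.
Proof. by []. Qed.

Lemma gauss_small n k : (n < k)%N -> T n k = 0.
Proof.
elim/ltn_ind: n k => -[_ [] //|[_ [|[|k]] //|n IH] [//|k] ltnk].
by rewrite gaussSS !IH ?mulr0 ?addr0 //; lia.
Qed.

Lemma gaussnn n : T n n = 1.
Proof.
case: n => // n; elim: n => // n IH.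
by rewrite gaussSS IH (@gauss_small n.+1 n.+2) // (@gauss_small n n.+1) //; ring.
Qed.

(** The recursion is itself symmetric: passing to the complementary index swaps its first two
    terms. *)
Lemma gauss_sym n k : (k <= n)%N -> T n (n - k) = T n k.
Proof.
elim/ltn_ind: n k => -[|[|n]] IH.
- by case.
- by case=> [|[]].
case=> [|k] lekn; first by rewrite subn0 gaussnn gaussn0.
have [->|ltkn] := eqVneq k n.+1; first by rewrite subnn gaussnn gaussn0.
have -> : (n.+2 - k.+1 = (n - k).+1)%N by lia.
rewrite !gaussSS IH; try lia.
have -> : (n - k).+1 = (n.+1 - k)%N by lia.
rewrite IH; try lia.
have -> : (n - k = n.+1 - k.+1)%N by lia.
by rewrite IH; try lia; ring.
Qed.

(* The generating function over ballot words is a difference of two Gaussian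
   binomials (reflection principle).  It holds slightly beyond the ballot
   region, on the line where it vanishes, hence the bound on [k]. *)
Lemma sum_sb h n k : (k.*2 <= n + h.+1)%N ->
  \sum_(w <- words n | sb h w && (ones w == k)) x ^+ maj_word w
  = T n k - (if (h < k)%N then T n (k - h.+1) else 0).
Proof.
(* As [sb] reads from the right, appending 0 raises the allowed height and appending 1 lowers it;
   only an appended 0 can create a descent, of weight N. *)
have rec N H K :
  \sum_(w <- words N.+1 | sb H w && (ones w == K)) x ^+ maj_word w
  = \sum_(w <- words N | sb H.+1 w && (ones w == K))
       x ^+ (maj_word w + last false w * N)
  + \sum_(w <- words N | (0 < H)%N && (0 < K)%N &&
                         (sb H.-1 w && (ones w == K.-1))) x ^+ maj_word w.
  rewrite big_mkcond sum_words_rcons big_split /=.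
  congr (_ + _); rewrite [RHS]big_mkcond.
    apply: eq_big_seq => w; rewrite mem_words => /eqP sw.
    by rewrite /sb rev_rcons /= ones_rcons addn0 maj_word_rcons andbT sw.
  apply: eq_big_seq => w; rewrite mem_words => /eqP sw.
  rewrite /sb rev_rcons /= ones_rcons addn1 maj_word_rcons andbF addn0.
  by case: K => [|K]; rewrite /= ?andbF //= andbT eqSS andbA.
have last1 N H K :
  \sum_(w <- words N.+1 | (sb H w && (ones w == K)) && last false w)
    x ^+ maj_word w
  = \sum_(w <- words N | (0 < H)%N && (0 < K)%N &&
                         (sb H.-1 w && (ones w == K.-1))) x ^+ maj_word w.
  rewrite big_mkcond sum_words_rcons big_split /= [X in X + _]big1 ?add0r.
    rewrite [RHS]big_mkcond; apply: eq_bigr => w _.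
    rewrite /sb rev_rcons /= ones_rcons addn1 maj_word_rcons last_rcons.
    by case: K => [|K]; rewrite /= !andbT ?andbF //= eqSS andbA addn0.
  by move=> w _; rewrite last_rcons andbF.
(* The new descent is isolated as a correction over words ending in 1, which [last1] shortens once
   more; hence the factor [x ^+ N - 1] of the Gaussian recursion. *)
have lastE N H K :
  \sum_(w <- words N | sb H w && (ones w == K))
       x ^+ (maj_word w + last false w * N)
  = \sum_(w <- words N | sb H w && (ones w == K)) x ^+ maj_word w
   + (x ^+ N - 1)
     * \sum_(w <- words N | (sb H w && (ones w == K)) && last false w)
       x ^+ maj_word w.
  rewrite big_distrr /= [X in _ = _ + X]big_mkcondr -big_split /=.
  apply: eq_bigr => w _; case: (last false w); last by rewrite !addr0 addn0.
  by rewrite mul1n exprD; ring.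
elim/ltn_ind: n h k => -[|[|n]] IH h k lek.
- rewrite big_cons big_nil /= maj_word_nil expr0 addr0 gauss0.
  have -> : (h < k)%N = false by lia.
  by case: k {lek} => [|k]; rewrite subr0.
- rewrite rec lastE expr0 subrr mul0r addr0 IH; try lia.
  have -> : (h.+1 < k)%N = false by lia.
  rewrite subr0; case: k lek => [|k] lek.
    by rewrite big_pred0 ?andbF // !gaussn0 /=; ring.
  case: h lek => [|h] lek.
    have -> : k = 0%N by lia.
    by rewrite big_pred0 // !gauss1 gauss0 /=; ring.
  rewrite IH /=; try lia.
  have -> : (h < k)%N = false by lia.
  have -> : (h.+1 < k.+1)%N = false by lia.
  by rewrite gauss0 gauss1 gauss0 /=; case: k {lek} => [|k] /=; ring.
rewrite rec lastE last1 IH; try lia.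
case: k lek => [|k] lek.
  by rewrite !big_pred0 ?andbF // !gaussn0 /=; ring.
rewrite IH /=; try lia.
(* For [h = 0] this still holds: no word qualifies, and the two binomials coincide. *)
have -> : \sum_(w <- words n.+1 | (0 < h)%N && true
              && (sb h.-1 w && (ones w == k))) x ^+ maj_word w
  = T n.+1 k - (if (h <= k)%N then T n.+1 (k - h) else 0).
  case: h {IH} lek (IH n.+1) => [|h] lek IH.
    by rewrite big_pred0 // subn0 subrr.
  by rewrite IH //; lia.
rewrite !subSS !ltnS; case: (ltngtP h k) => [lthk|_|->].
- have [i ei] : {i | (k - h = i.+1)%N} by exists (k - h).-1; lia.
  have -> : (k - h.+1 = i)%N by lia.
  by rewrite ei !gaussSS; ring.
- by rewrite gaussSS; ring.
by rewrite subnn !gaussn0 gaussSS; ring.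
Qed.

(** The bound on [k] makes a final 1 always admissible, so the height can stay 0 throughout the
    induction. Complementing makes the weight record the factors 01 of [w]. *)
Lemma sum_pb n k : (k.*2 <= n.+1)%N ->
  \sum_(w <- words n | pb 0 w && (ones w == k)) x ^+ maj_word (map negb w)
  = T n k - (if (0 < k)%N then T n k.-1 else 0).
Proof.
have rec N K : (K.*2 <= N.+1)%N ->
  \sum_(w <- words N.+1 | pb 0 w && (ones w == K)) x ^+ maj_word (map negb w)
  = \sum_(w <- words N | pb 0 w && (ones w == K)) x ^+ maj_word (map negb w)
  + \sum_(w <- words N | (0 < K)%N && (pb 0 w && (ones w == K.-1)))
      x ^+ (maj_word (map negb w) + ~~ last true w * N).
  move=> leK; rewrite big_mkcond sum_words_rcons big_split /=.
  congr (_ + _); rewrite [RHS]big_mkcond; apply: eq_big_seq => w.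
    rewrite mem_words => /eqP sw.
    rewrite pb_rcons ones_rcons addn0 map_rcons maj_word_rcons /=.
    by rewrite andbT andbF addn0.
  rewrite mem_words => /eqP sw.
  rewrite pb_rcons ones_rcons addn1 map_rcons maj_word_rcons size_map sw andbT.
  have -> : (last false (map negb w) * N = ~~ last true w * N)%N.
    by case/lastP: w sw => [<-|w c _]; rewrite ?muln0 // map_rcons !last_rcons.
  case: K leK => [|K] leK; rewrite /= ?andbF // eqSS.
  case: (pb 0 w) => //=.
  case: (eqVneq (ones w) K) => [eK|]; last by rewrite andbF.
  by rewrite ifT //; have := ones_zeros w; rewrite sw; lia.
have last1 N K :
  \sum_(w <- words N.+1 | (pb 0 w && (ones w == K)) && ~~ last true w)
     x ^+ maj_word (map negb w)
  = \sum_(w <- words N | pb 0 w && (ones w == K)) x ^+ maj_word (map negb w).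
  rewrite big_mkcond sum_words_rcons big_split /= [X in _ + X]big1 ?addr0.
    rewrite [RHS]big_mkcond; apply: eq_bigr => w _.
    rewrite pb_rcons ones_rcons addn0 map_rcons maj_word_rcons last_rcons.
    by rewrite /= andbF addn0 !andbT.
  by move=> w _; rewrite last_rcons andbF.
have lastE N K :
  \sum_(w <- words N | pb 0 w && (ones w == K))
      x ^+ (maj_word (map negb w) + ~~ last true w * N)
  = \sum_(w <- words N | pb 0 w && (ones w == K)) x ^+ maj_word (map negb w)
   + (x ^+ N - 1)
     * \sum_(w <- words N | (pb 0 w && (ones w == K)) && ~~ last true w)
       x ^+ maj_word (map negb w).
  rewrite big_distrr /= [X in _ = _ + X]big_mkcondr -big_split /=.
  apply: eq_bigr => w _; case: (last true w); first by rewrite !addr0 addn0.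
  by rewrite /= mul1n exprD; ring.
(* On the boundary line there are more 1s than 0s, so no word qualifies, and the binomials cancel by
   symmetry. Off this line, the bound is strong enough for [rec] and the induction hypothesis. *)
have vanish n' k' : (k'.*2 = n'.+1)%N ->
  \sum_(w <- words n' | pb 0 w && (ones w == k')) x ^+ maj_word (map negb w)
  = T n' k' - (if (0 < k')%N then T n' k'.-1 else 0).
  case: k' => // k' e; rewrite big1_seq /=.
    rewrite -(@gauss_sym n' k'); last by lia.
    have -> : (n' - k' = k'.+1)%N by lia.
    by rewrite subrr.
  move=> w /andP[/andP[/pb_count H /eqP H2]]; rewrite mem_words => /eqP sw.
  by have := ones_zeros w; rewrite sw; lia.
elim/ltn_ind: n k => -[|[|n]] IH k; rewrite leq_eqVlt => /orP[/eqP/vanish//|lek].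
- have -> : k = 0%N by lia.
  by rewrite big_cons big_nil /= maj_word_nil expr0 !addr0 gauss0 subr0.
- have -> : k = 0%N by lia.
  rewrite rec // IH // big_pred0 // gauss0 gauss1 /=; ring.
rewrite rec; last by lia.
rewrite IH; try lia.
case: k lek => [|k] lek.
  by rewrite big_pred0 // !gaussn0 /=; ring.
rewrite [X in _ + X = _]lastE last1 !IH; try lia.
by case: k lek => [|k] lek; rewrite !gaussSS ?gaussn0 /=; ring.
Qed.

(** The equidistribution behind the theorem: both closed forms are the same difference of Gaussian
    binomials. *)
Lemma sum_sb_pb n k : (k.*2 <= n)%N ->
  \sum_(w <- words n | sb 0 w && (ones w == k)) x ^+ maj_word w
  = \sum_(w <- words n | pb 0 w && (ones w == k)) x ^+ maj_word (map negb w).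
Proof. by move=> lek; rewrite sum_sb ?sum_pb ?subn1 //; lia. Qed.

End Gauss.

(** * Catalan words *)

Lemma sum_pairs (V : nmodType) (I J : Type) (s : seq I) (t : seq J)
    (P : pred I) (Q : I -> pred J) (F : I -> J -> V) :
  \sum_(i <- s | P i) \sum_(j <- t | Q i j) F i j
  = \sum_(x <- [seq (i, j) | i <- s, j <- t] | P x.1 && Q x.1 x.2) F x.1 x.2.
Proof.
rewrite [RHS]big_mkcond big_allpairs_dep [LHS]big_mkcond.
apply: eq_bigr => i _ /=.
by case: (P i); [exact: big_mkcond | rewrite big1].
Qed.

Lemma sum_tuple_words (V : nmodType) n (P : pred (seq bool))
    (F : seq bool -> V) :
  \sum_(w : n.-tuple bool | P w) F w = \sum_(w <- words n | P w) F w.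
Proof.
rewrite -(big_map (fun w : n.-tuple bool => tval w) P F).
apply: perm_big; apply: uniq_perm.
- by rewrite map_inj_uniq ?index_enum_uniq //; apply: val_inj.
- exact: words_uniq.
move=> w; rewrite mem_words; apply/mapP/idP => [[t _ ->]|sw].
  by rewrite size_tuple.
by exists (Tuple sw); rewrite ?mem_index_enum.
Qed.

Lemma is_catalanE n w :
  is_catalan n w = [&& size w == n.*2, ones w == n & pb 0 w].
Proof.
rewrite /is_catalan; case: eqP => //= sw; congr (_ && _).
apply/forallP/pbP => [H m | H m]; last exact: (H m).
have [lem|ltm] := leqP m n.*2.
  by have := H (Ordinal (lem : (m < (n.*2).+1)%N)).
rewrite take_oversize ?sw; last exact: ltnW.
by have := H ord_max; rewrite /= take_oversize ?sw.
Qed.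

Lemma sbP h w :
  reflect (forall m, (ones (drop m w) <= h + zeros (drop m w))%N) (sb h w).
Proof.
apply: (iffP (pbP _ _)) => H m.
  have := H (size w - m)%N; rewrite take_rev ones_rev zeros_rev.
  have [lem|ltm] := leqP m (size w); first by rewrite subKn.
  by move=> _; rewrite drop_oversize // ltnW.
by rewrite take_rev ones_rev zeros_rev; apply: H.
Qed.

(** Once the total excess of 0s over 1s is [h], bounding a prefix of the complement amounts to
    bounding the suffix of [w] that remains. *)
Lemma pb_negb h w : (h + ones w = zeros w)%N -> pb h (map negb w) = sb 0 w.
Proof.
move=> e; apply/pbP/sbP => H m; have := H m.
  rewrite -map_take ones_negb zeros_negb.
  by have := e; rewrite -{1 2}(cat_take_drop m w) ones_cat zeros_cat; lia.
rewrite -map_take ones_negb zeros_negb.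
by have := e; rewrite -{1 2}(cat_take_drop m w) ones_cat zeros_cat; lia.
Qed.

Lemma pb_sb_rev h w : pb h w = sb h (rev w).
Proof. by rewrite /sb revK. Qed.

(* A Catalan word is cut at its midpoint; both halves become words all of whose
   suffixes are ballot, by reversal and by complementation respectively. *)
Lemma sum_catalan (V : nmodType) n (F : nat -> nat -> V) :
  (forall a b k, F (a + k)%N (b + k)%N = F a b) ->
  \sum_(w : (n.*2).-tuple bool | is_catalan n w)
     F (maj_word w) (maj_word (word_inv w))
  = \sum_(r <- words n | sb 0 r)
      \sum_(s <- words n | sb 0 s && (ones s == ones r))
        F (2 * maj_word r)%N (2 * maj_word s)%N.
Proof.
move=> HF; pose G w := F (maj_word w) (maj_word (word_inv w)).
rewrite (@sum_tuple_words _ _ (is_catalan n) G) sum_pairs; symmetry.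
pose f (x : seq bool * seq bool) := rev x.2 ++ map negb x.1.
pose g (w : seq bool) := (map negb (drop n w), rev (take n w)).
transitivity (\sum_(x <- [seq (r, s) | r <- words n, s <- words n]
                  | sb 0 x.1 && (sb 0 x.2 && (ones x.2 == ones x.1))) G (f x)).
  rewrite big_seq_cond [RHS]big_seq_cond; apply: eq_bigr => -[r s] /=.
  case/and4P=> /allpairsP[[r' s'] /= [Hr Hs [-> ->]]].
  move=> /maj_word_sb mr /maj_word_sb ms /eqP ers.
  move: Hr Hs; rewrite !mem_words => /eqP sr /eqP ss.
  have es : word_inv (rev s') = map negb s' by rewrite /word_inv map_rev revK.
  have := @maj_cat_word_inv (rev s') (map negb r').
  rewrite size_rev size_map sr ss es /G /f /= => /(_ erefl) e.
  (* Both arguments are raised by a common amount so that [e] applies without any subtraction. *)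
  rewrite -(HF (maj_word (rev s' ++ _)) _ (2 * maj_word (map negb s'))%N).
  rewrite e [in RHS]addnC [in RHS](addnC _ (2 * maj_word (map negb s'))%N) HF.
  by rewrite mr ms ers !mulnDr HF.
apply: (sum_seq_bij (g := g)).
- by apply: allpairs_uniq => [||[? ?] [? ?] _ _ /= []->->//]; apply: words_uniq.
- exact: words_uniq.
- move=> [r s] /allpairsP[[r' s'] /= [Hr Hs [-> ->]]] /and3P[sbr sbs /eqP e].
  move: Hr Hs; rewrite !mem_words => /eqP sr /eqP ss.
  have szf : size (f (r', s')) = n.*2.
    by rewrite size_cat size_rev size_map sr ss addnn.
  have := ones_zeros r'; have := ones_zeros s'; rewrite sr ss => eo' eo.
  have bs : (ones s' <= zeros s')%N.
    by have := pb_count sbs; rewrite ones_rev zeros_rev.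
  split; last 1 first.
  + rewrite /g take_size_cat ?size_rev // drop_size_cat ?size_rev // revK.
    by rewrite -map_comp (eq_map negbK) map_id.
  + by rewrite szf.
  rewrite is_catalanE szf eqxx /= ones_cat ones_rev ones_negb pb_cat.
  rewrite pb_sb_rev revK sbs ones_rev zeros_rev add0n.
  rewrite pb_negb ?sbr; last by move=> /=; lia.
  by rewrite andbT /=; lia.
move=> /= w; rewrite mem_words is_catalanE => /eqP sw /and3P[_ /eqP ow pw].
have st : size (take n w) = n by rewrite size_takel // sw; lia.
have sd : size (drop n w) = n by rewrite size_drop sw; lia.
move: ow pw; rewrite -{1 2}(cat_take_drop n w) ones_cat pb_cat => ow /andP[pt pd].
have ct := pb_count pt; have := ones_zeros (take n w).
have := ones_zeros (drop n w); rewrite st sd => od ot.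
split; last 1 first.
- by rewrite /f /g /= revK -map_comp (eq_map negbK) map_id cat_take_drop.
- apply/allpairsP; exists (g w) => /=.
  by rewrite !mem_words size_map size_rev st sd.
rewrite /= {2}/sb revK pt ones_negb ones_rev.
(* The second half starts with the margin left by the first; [ct] ensures that this difference is
   not truncated. *)
rewrite -(@pb_negb (zeros (take n w) - ones (take n w))); last first.
  rewrite ones_negb zeros_negb.
  by move: (ones _) (ones _) (zeros _) (zeros _) ct od ot ow => *; lia.
by rewrite -map_comp (eq_map negbK) map_id -[X in pb X]add0n addnBA // pd; lia.
Qed.

(** * Permutations avoiding 123 *)

Definition perm_word n (s : 'S_n) : seq nat := [seq val (s i) | i <- enum 'I_n].

Definition push (l : seq nat) (x : nat) : seq nat := rcons (map (bump x) l) x.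

Lemma size_perm_word n (s : 'S_n) : size (perm_word s) = n.
Proof. by rewrite size_map size_enum_ord. Qed.

Lemma nth_perm_word n (s : 'S_n) (i : 'I_n) : nth 0%N (perm_word s) i = s i.
Proof.
by rewrite (nth_map i) ?size_enum_ord // nth_ord_enum.
Qed.

Lemma perm_word_lift n (x : 'I_n.+1) (s : 'S_n) :
  perm_word (lift_perm ord_max x s) = push (perm_word s) x.
Proof.
rewrite /perm_word enum_ordSr map_rcons lift_perm_id /push; congr rcons.
rewrite -!map_comp; apply: eq_map => i /=.
have -> : widen_ord (leqnSn n) i = lift ord_max i.
  by apply: val_inj; apply/esym/lift_max.
by rewrite lift_perm_lift.
Qed.

(** A permutation is determined by its final value and the standardisation of the other values. *)
Lemma sum_perm_lift (V : nmodType) n (F : seq nat -> V) :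
  \sum_(s : 'S_n.+1) F (perm_word s)
  = \sum_(s : 'S_n) \sum_(x <- iota 0 n.+1) F (push (perm_word s) x).
Proof.
rewrite -val_enum_ord.
pose lp (p : 'S_n * 'I_n.+1) := lift_perm ord_max p.2 p.1.
have lp_inj : injective lp.
  move=> [s x] [s' x']; rewrite /lp /= => e.
  have ex : x = x'.
    have := congr1 (fun f : 'S_n.+1 => f ord_max) e.
    by rewrite !lift_perm_id.
  congr (_, _) => //; apply/permP => i; apply: (@lift_inj _ x).
  by rewrite -(lift_perm_lift ord_max x s) e {1}ex lift_perm_lift -ex.
have lp_bij : bijective lp.
  apply: inj_card_bij => //.
  by rewrite card_prod !card_Sn card_ord factS mulnC.
rewrite (reindex lp) /=; last exact: onW_bij.
rewrite -(pair_bigA _ (fun s x => F (perm_word (lp (s, x))))) /=.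
apply: eq_bigr => s _; rewrite big_map big_enum /=.
by apply: eq_bigr => x _; rewrite perm_word_lift.
Qed.

Definition av123 (l : seq nat) : bool :=
  [forall i : 'I_(size l), forall j : 'I_(size l), forall k : 'I_(size l),
     (i < j < k)%N ==> ~~ (nth 0 l i < nth 0 l j < nth 0 l k)%N].

Lemma av123P l :
  reflect (forall i j k, (i < j)%N -> (j < k)%N -> (k < size l)%N ->
             ~ (nth 0 l i < nth 0 l j < nth 0 l k)%N) (av123 l).
Proof.
apply: (iffP idP) => [/forallP H i j k ij jk kl|H].
  have jl := ltn_trans jk kl; have il := ltn_trans ij jl.
  have /forallP/(_ (Ordinal jl))/forallP/(_ (Ordinal kl)) := H (Ordinal il).
  by rewrite /= ij jk /= => /negP.
apply/forallP => i; apply/forallP => j; apply/forallP => k.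
by apply/implyP => /andP[ij jk]; apply/negP/H.
Qed.

Lemma avoids123E n (s : 'S_n) : avoids123 s = av123 (perm_word s).
Proof.
apply/idP/av123P; rewrite ?size_perm_word => H.
  move=> i j k ij jk kn; have jn := ltn_trans jk kn; have in_ := ltn_trans ij jn.
  pose I := Ordinal in_; pose J := Ordinal jn; pose K := Ordinal kn.
  rewrite -[i]/(val I) -[j]/(val J) -[k]/(val K) !nth_perm_word => /andP[sij sjk].
  have sik := ltn_trans sij sjk; have ik := ltn_trans ij jk.
  have : increasing_on s [set I; J; K].
    apply/forall_inP => a; rewrite !inE -orbA => Ha; apply/forall_inP => b.
    rewrite !inE -orbA => Hb; apply/implyP.
    case/or3P: Ha => /eqP ->; case/or3P: Hb => /eqP ->;
      by rewrite /= ?ltnn //; lia.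
  move=> inc; have := leq_trans (leq_bigmax_cond _ inc) H.
  rewrite setUC cardsU1 !inE cards2 -!val_eqE /=.
  have -> : (k == i) = false by lia.
  have -> : (k == j) = false by lia.
  by have -> : (i == j) = false by lia.
apply/bigmax_leqP => A incA; rewrite leqNgt; apply/card_gt2P.
have K a b c : a \in A -> b \in A -> c \in A -> (a < b)%N -> (b < c)%N -> False.
  have sA i j : i \in A -> j \in A -> (i < j)%N -> (s i < s j)%N.
    move=> iA jA; move/forall_inP: incA => /(_ i iA)/forall_inP/(_ j jA).
    by move/implyP; apply.
  move=> aA bA cA ab bc; apply: (H a b c ab bc (ltn_ord c)).
  by rewrite !nth_perm_word !sA.
case=> x [y [z [[xA yA zA] []]]]; rewrite -!val_eqE /=.
case: (ltngtP x y) => // xy _; case: (ltngtP y z) => // yz _;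
  case: (ltngtP z x) => // zx _; try lia; by [exact: (K x y z) |
  exact: (K x z y) | exact: (K y x z) | exact: (K y z x) |
  exact: (K z x y) | exact: (K z y x)].
Qed.

(** * Insertion of a new last value *)

Lemma size_push l x : size (push l x) = (size l).+1.
Proof. by rewrite size_rcons size_map. Qed.

Lemma nth_push l x i : nth 0%N (push l x) i =
  if (i < size l)%N then bump x (nth 0 l i) else if i == size l then x else 0%N.
Proof.
rewrite nth_rcons size_map; case: ltnP => // il.
by rewrite (nth_map 0%N).
Qed.

Lemma ltn_bump x a b : (bump x a < bump x b)%N = (a < b)%N.
Proof. by rewrite /bump; case: (leqP x a); case: (leqP x b); lia. Qed.

Lemma bump_ltn x a : (bump x a < x)%N = (a < x)%N.
Proof. by rewrite /bump; case: (leqP x a); lia. Qed.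

(** A new occurrence of 123 has [x] as its largest entry, and [bump] preserves both the order and
    the comparison with [x]. *)
Lemma av123_push l x : av123 (push l x) =
  av123 l && [forall i : 'I_(size l), forall j : 'I_(size l),
     (i < j)%N ==> ~~ (nth 0 l i < nth 0 l j < x)%N].
Proof.
apply/av123P/andP => [H|[/av123P H1 /forallP H2] i j k ij jk].
  split.
    apply/av123P => i j k ij jk kl; have := H i j k ij jk.
    rewrite size_push !nth_push kl (ltn_trans jk kl).
    by rewrite (ltn_trans ij (ltn_trans jk kl)) !ltn_bump; apply; lia.
  apply/forallP => i; apply/forallP => j; apply/implyP => ij; apply/negP.
  have := H i j (size l) ij (ltn_ord j); rewrite size_push !nth_push !ltn_ord.
  by rewrite ltnn eqxx ltn_bump bump_ltn; apply.
rewrite size_push ltnS leq_eqVlt => /orP[/eqP ek|kl].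
  rewrite ek in jk; rewrite !nth_push ek ltnn eqxx jk (ltn_trans ij jk).
  rewrite ltn_bump bump_ltn.
  have /forallP/(_ (Ordinal jk))/implyP := H2 (Ordinal (ltn_trans ij jk)).
  by move=> /(_ ij)/negP.
rewrite !nth_push kl (ltn_trans jk kl) (ltn_trans ij (ltn_trans jk kl)).
by rewrite !ltn_bump; apply: H1.
Qed.

(* One Robinson-Schensted insertion, for the reversed order on values, so that
   avoiding 123 means having at most two rows.  The insertion tableau is encoded
   by the word [r] telling in which row each value lies; inserting [x] renumbers
   the values from [x] on and bumps the largest smaller value of the first row.
   [ok r x] says that the tableau keeps at most two rows, and [bit r x] is the
   row in which the new cell appears. *)
Definition ok (r : seq bool) (x : nat) : bool := sorted implb (take x r).
Definition ins (r : seq bool) (x : nat) : seq bool :=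
  behead (rcons (take x r) true) ++ false :: drop x r.
Definition bit (r : seq bool) (x : nat) : bool := (0 < x)%N && ~~ head true r.

Lemma okP r x : (x <= size r)%N ->
  reflect (forall i, (i.+1 < x)%N -> nth false r i -> nth false r i.+1) (ok r x).
Proof.
move=> xr; apply: (iffP (sortedP false)); rewrite size_takel // => H i ix.
  by have := H i ix; rewrite !nth_take ?(ltnW ix) // => /implyP.
by rewrite !nth_take ?(ltnW ix) //; apply/implyP/H.
Qed.

Lemma size_ins r x : (x <= size r)%N -> size (ins r x) = (size r).+1.
Proof.
by move=> xr; rewrite size_cat size_behead size_rcons size_takel //= size_drop; lia.
Qed.

Lemma nth_ins r x i : (x <= size r)%N -> nth false (ins r x) i =
  if (i.+1 < x)%N then nth false r i.+1 else if i.+1 == x then true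
  else if i == x then false else nth false r i.-1.
Proof.
move=> xr; rewrite nth_cat size_behead size_rcons size_takel //= nth_behead.
rewrite nth_rcons size_takel //.
case: (ltngtP i.+1 x) => [ix|xi|_] //.
  by rewrite nth_take.
case: (eqVneq i x) => [->|nix]; first by rewrite subnn.
have -> : (i - x = (i - x).-1.+1)%N by lia.
by rewrite /= nth_drop; congr nth; lia.
Qed.

(** The state after [n] insertions: the permutation word, the insertion tableau and the recording
    tableau. Ascents of the inverse are factors 10 of [r], ascents are factors 01 of [v]. The field
    [run_last] anticipates every admissible next value, which makes [run_desc] inductive. *)
Record run_inv n (l : seq nat) (r v : seq bool) : Prop := RunInv {
  run_size_l : size l = n;
  run_uniq : uniq l;
  run_mem : forall i, (i \in l) = (i < n)%N;
  run_size_r : size r = n;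
  run_size_v : size v = n;
  run_av : av123 l;
  run_idesc : forall i, (i.+1 < n)%N ->
    (index i l < index i.+1 l)%N = nth false r i && ~~ nth false r i.+1;
  run_desc : forall i, (i.+1 < n)%N ->
    (nth 0 l i < nth 0 l i.+1)%N = ~~ nth false v i && nth false v i.+1;
  run_last : forall x, (0 < n)%N -> (x <= n)%N -> ok r x ->
    (last 0 l < x)%N = ~~ last true v && bit r x }.

(** If [r] has no factor 10 before [x], then by [run_idesc] the values below [x] stand in decreasing
    order, so none of their pairs extends to 123. A factor 10 there gives consecutive values
    standing in increasing order. *)
Lemma run_ok n l r v x : run_inv n l r v -> (x <= n)%N ->
  av123 (push l x) = ok r x.
Proof.
move=> [sl ul ml sr _ avl Hi _ _] xn; rewrite av123_push avl /=.
have xr : (x <= size r)%N by rewrite sr.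
apply/idP/(okP xr) => [/forallP H i ix ri|H].
  apply: contraTT ri => ri1.
  have il : i \in l by rewrite ml; lia.
  have i1l : i.+1 \in l by rewrite ml; lia.
  apply/negP => ri; have lti : (index i l < index i.+1 l)%N.
    by rewrite Hi ?ri // (leq_trans ix).
  move: il i1l; rewrite -!index_mem => il i1l.
  have /forallP/(_ (Ordinal i1l))/implyP/(_ lti) := H (Ordinal il).
  by rewrite /= !nth_index -?index_mem // ltnSn ix.
apply/forallP => i; apply/forallP => j; apply/implyP => ij.
apply/negP => /andP[lij ljx].
have Hd d : (nth 0 l i + d < x)%N ->
    (index (nth 0 l i + d) l <= index (nth 0 l i) l)%N.
  elim: d => [|d IH] ltx; first by rewrite addn0.
  rewrite addnS; apply: leq_trans (IH _); last by lia.
  rewrite leqNgt Hi; last by lia.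
  by apply/negP => /andP[h1 /negP]; apply; apply: H => //; lia.
have := Hd (nth 0 l j - nth 0 l i)%N; rewrite subnKC; last exact: ltnW.
by move=> /(_ ljx); rewrite !index_uniq //; lia.
Qed.

Lemma index_push_bump l x i : i \in l -> index (bump x i) (push l x) = index i l.
Proof.
move=> il; rewrite /push -cats1 index_cat mem_map; last exact: can_inj (bumpK _).
by rewrite il index_map //; exact: can_inj (bumpK _).
Qed.

Lemma index_push l x : index x (push l x) = size l.
Proof.
rewrite /push -cats1 index_cat ifN /= ?eqxx ?addn0 ?size_map //.
by apply/mapP => -[i _ e]; have := neq_bump x i; rewrite -e eqxx.
Qed.

Lemma run_step n l r v x : run_inv n l r v -> (x <= n)%N -> ok r x ->
  run_inv n.+1 (push l x) (ins r x) (rcons v (bit r x)).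
Proof.
move=> inv xn okx; have := inv => -[sl ul ml sr sv avl Hi Hd Hl].
have xr : (x <= size r)%N by rewrite sr.
have Hok := okP xr okx.
split.
- by rewrite size_push sl.
- rewrite rcons_uniq map_inj_uniq ?ul ?andbT; last exact: can_inj (bumpK _).
  by apply/mapP => -[i _ e]; have := neq_bump x i; rewrite -e eqxx.
- move=> i; rewrite mem_rcons inE; have [->|nix] := eqVneq i x; first by rewrite ltnS.
  have -> : i = bump x (unbump x i) by rewrite unbumpK // inE.
  rewrite mem_map ?ml; last exact: can_inj (bumpK _).
  by rewrite unbumpK ?inE // /unbump; case: (ltnP x i) => /=; lia.
- by rewrite size_ins // sr.
- by rewrite size_rcons sv.
- by rewrite (run_ok inv).
- move=> i; rewrite ltnS => iltn; rewrite !nth_ins //.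
  have b1 j : (j < x)%N -> bump x j = j by rewrite /bump; lia.
  have b2 j : (x <= j)%N -> bump x j = j.+1 by rewrite /bump; lia.
  (* Below [x], admissibility excludes factors 10 before and after the insertion; above [x],
     everything is shifted by one. The value [x] itself stands last, so it comes after both [x.-1]
     and [x.+1]. *)
  case: (ltngtP i.+1 x) => [ix|xi|ex].
  + rewrite -{1}[i]b1 ?(ltnW ix) // -{1}[i.+1]b1 // !index_push_bump ?ml //; try lia.
    rewrite Hi //; last lia.
    have -> : nth false r i && ~~ nth false r i.+1 = false.
      by apply/negP => /andP[h1 /negP]; apply; apply: Hok.
    case: (ltngtP i.+2 x) => [ix2|ix2|_]; try lia.
    by apply/esym/negP => /andP[h1 /negP]; apply; apply: Hok.
  + case: (eqVneq i x) => [ei|nix].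
      rewrite ei in iltn *; rewrite index_push /=.
      have -> : x.+1 = bump x x by rewrite b2.
      by rewrite index_push_bump ?ml //; apply/negbTE; rewrite -leqNgt index_size.
    have xi' : (x < i)%N by lia.
    rewrite !ifN; try lia.
    have [j ej] : {j | i = j.+1} by exists i.-1; lia.
    rewrite ej in iltn xi' *.
    have e1 k : (x <= k)%N -> (k < n)%N -> index k.+1 (push l x) = index k l.
      by move=> xk kn; rewrite -(b2 k) // index_push_bump // ml.
    by rewrite !e1 ?Hi //; lia.
  + rewrite -ex index_push -{1}[i]b1 -?ex // index_push_bump ?ml; last by lia.
    by rewrite index_mem ml ifN ?ifN //; lia.
- move=> i; rewrite ltnS => iltn; rewrite !nth_push sl !nth_rcons sv iltn.
  have [ltin|lein|ein] := ltngtP i.+1 n; try lia.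
    by rewrite ltn_bump Hd.
  have el : nth 0%N l i = last 0%N l by rewrite -nth_last sl -ein.
  have ev : nth false v i = last true v.
    by rewrite (set_nth_default true) ?sv // -nth_last sv -ein.
  by rewrite bump_ltn el ev Hl //; lia.
move=> x' _ x'n okx'; rewrite /push last_rcons last_rcons.
have x'u : (x' <= size (ins r x))%N by rewrite size_ins // sr.
have Hok' := okP x'u okx'.
(* If [x < x'], then [x = 0]: otherwise the new word has a factor 10 at [x.-1] and [x], which [ok]
   forbids below [x']. *)
case: (ltnP x x') => [ltxx'|lex'x].
  have x0 : x = 0%N.
    apply/eqP; rewrite -leqn0 leqNgt; apply/negP => x0.
    have := Hok' x.-1; rewrite !nth_ins // prednK // ltnn eqxx /= => /(_ ltxx' isT).
    by rewrite ifN ?ifN //; lia.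
  by move: ltxx'; rewrite x0 /bit /ins take0 /= => ->.
(* If nothing was bumped and [0 < x], all values below [x] lie in the second row, so the new word
   begins with 1 and the next bit is 0. *)
apply/esym/negbTE; rewrite /bit; apply/negP => /and3P[].
rewrite negb_and negbK -leqNgt => nb x'0.
have x0 : (0 < x)%N by lia.
move: nb; rewrite leqNgt x0 /= => hr.
have -> : head true (ins r x) = nth false (ins r x) 0.
  by case: (ins r x) (size_ins xr).
rewrite nth_ins //; case: (ltngtP 1 x) => // [x1|]; last by lia.
rewrite Hok //; case: r {inv Hi Hl Hok okx x'u okx' Hok'} sr hr xr => //=; lia.
Qed.

(** * Inverting the insertion step on ballot words *)

Lemma sb_cat h u w : sb h (u ++ w) = sb h w && sb (h + zeros w - ones w) u.
Proof. by rewrite /sb rev_cat pb_cat zeros_rev ones_rev. Qed.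

Lemma sb_cons h b w : sb h (b :: w) = sb h w && (b ==> (ones w < h + zeros w)%N).
Proof. by rewrite /sb rev_cons pb_rcons ones_rev zeros_rev. Qed.

Lemma sb_count h w : sb h w -> (ones w <= h + zeros w)%N.
Proof. by move/pb_count; rewrite ones_rev zeros_rev. Qed.

Lemma sb_nseq h x : sb h (nseq x true) = (x <= h)%N.
Proof.
rewrite /sb rev_nseq; by elim: x h => [|x IH] [|h] //=.
Qed.

Lemma ones_nseq x : ones (nseq x true) = x.
Proof. by elim: x => //= x IH; rewrite ones_cons IH. Qed.

Lemma take_index_false u : take (index false u) u = nseq (index false u) true.
Proof. by elim: u => //= -[] u IH //=; rewrite IH. Qed.

Lemma index_nseq_true x w : index false (nseq x true ++ false :: w) = x.
Proof. by elim: x => //= x ->. Qed.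

Lemma sorted_nseq_true x : sorted implb (nseq x true).
Proof. by case: x => //= x; elim: x. Qed.

Lemma take_bit0 r x : ok r x -> ~~ bit r x -> (x <= size r)%N ->
  take x r = nseq x true.
Proof.
rewrite /ok /bit; case: x => [|x]; first by rewrite take0.
case: r => // -[] r //=; elim: r x => [|c r IH] [|x] //= /andP[c1 H] _ xr.
by case: c c1 H IH => // _ H IH; rewrite IH.
Qed.

Lemma ins_nseq x w : ins (nseq x true ++ w) x = nseq x true ++ false :: w.
Proof.
rewrite /ins take_size_cat ?size_nseq // drop_size_cat ?size_nseq //.
by congr (_ ++ _); case: x => //= x; elim: x => //= x ->.
Qed.

Lemma ins_cons0 u w :
  ins (false :: u ++ w) (size u).+1 = u ++ [:: true, false & w].
Proof.
rewrite /ins /= take_size_cat // drop_size_cat //.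
by rewrite -cats1 -catA.
Qed.

(** Locates, counting from 0, the 1 of the first factor 10, where a bumping insertion left its
    trace. *)
Fixpoint descent (u : seq bool) : nat :=
  if u is a :: t then if a && ~~ head true t then 0 else (descent t).+1 else 0.

Lemma descent_cat u w : sorted implb u ->
  descent (u ++ [:: true, false & w]) = size u.
Proof.
elim: u => //= a u IH Hs; rewrite IH ?(path_sorted Hs) //.
by case: u a Hs {IH} => [|c u] [] //= /andP[]; case: c.
Qed.

Lemma descent_split u : true \in u -> last false u = false ->
  exists a w, u = a ++ [:: true, false & w] /\ sorted implb a.
Proof.
elim: u => // c u IH; rewrite inE => Hc Hl.
have [tu|ntu] := boolP (true \in u).
  have Hl' : last false u = false by case: u tu Hl {IH Hc}.
  have [a [w [eu sa]]] := IH tu Hl'.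
  case: c {Hc Hl}; last first.
    by exists (false :: a), w; rewrite eu; split => //=; case: a sa {eu}.
  case: a eu sa => [|[] a] eu sa.
  + by exists [:: true], w; rewrite eu.
  + by exists [:: true, true & a], w; rewrite eu.
  by exists [::], (a ++ [:: true, false & w]); rewrite eu.
case: c Hc Hl => [_|]; last by rewrite (negbTE ntu).
case: u ntu {IH} => [//|[|] u]; first by rewrite inE.
by move=> _ _; exists [::], u.
Qed.

(** An insertion that bumps nothing puts a 0 right after a leading block of [x] 1s; its inverse
    deletes the first 0. The bound on [k] keeps the shortened word ballot. *)
Lemma bij_bit0 (V : nmodType) n k (F : seq bool -> V) : (k.*2 <= n)%N ->
  \sum_(r <- words n | sb 0 r && (ones r == k))
    \sum_(x <- iota 0 n.+1 | ok r x && ~~ bit r x) F (ins r x)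
  = \sum_(u <- words n.+1 | sb 0 u && (ones u == k)) F u.
Proof.
move=> lek; rewrite sum_pairs.
pose f (p : seq bool * nat) := ins p.1 p.2.
pose g (u : seq bool) :=
  (take (index false u) u ++ drop (index false u).+1 u, index false u).
apply: (sum_seq_bij (f := f) (g := g)).
- apply: allpairs_uniq; [exact: words_uniq|exact: iota_uniq|].
  by move=> [? ?] [? ?] _ _.
- exact: words_uniq.
- move=> [r0 x0] /allpairsP[[r' x'] [Hr Hx [-> ->]]].
  move: Hr Hx; rewrite mem_words mem_iota add0n /= => /eqP sr xn.
  case/andP=> /andP[sbr or] /andP[okx bx]; rewrite ltnS -sr in xn.
  move: sbr or sr; rewrite -(cat_take_drop x' r') (take_bit0 okx bx xn).
  move: (drop x' r') => w sbr or sr.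
  rewrite /f /g /= ins_nseq index_nseq_true; split.
  + by rewrite mem_words -sr !size_cat /= addnS.
  + move: sbr or; rewrite !sb_cat !sb_nseq sb_cons andbT !ones_cat.
    rewrite ones_cons zeros_cons => /andP[-> H] ->; rewrite andbT /=; lia.
  rewrite take_size_cat ?size_nseq // -cat_rcons drop_size_cat //.
  by rewrite size_rcons size_nseq.
move=> u; rewrite mem_words => /eqP su /andP[sbu /eqP ou].
have fu : false \in u.
  case/lastP: u su sbu {ou} => // u [] //; rewrite /sb rev_rcons //.
  by rewrite mem_rcons inE.
have [x [w eu]] : exists x w, u = nseq x true ++ false :: w.
  exists (index false u), (drop (index false u).+1 u).
  rewrite -take_index_false -{1}(cat_take_drop (index false u) u).
  by rewrite (drop_nth false) ?index_mem // nth_index.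
rewrite {}eu in su sbu ou fu *.
have -> : g (nseq x true ++ false :: w) = (nseq x true ++ w, x).
  rewrite /g index_nseq_true take_size_cat ?size_nseq // -cat_rcons.
  by rewrite drop_size_cat // size_rcons size_nseq.
split; last exact: ins_nseq.
  apply/allpairsP; exists (nseq x true ++ w, x); split => //.
    by move: su; rewrite mem_words !size_cat /= addnS => -[->].
  by rewrite mem_iota -su size_cat size_nseq /=; lia.
move: sbu ou su; rewrite !sb_cat !sb_nseq sb_cons andbT !ones_cat size_cat.
rewrite ones_cons zeros_cons size_nseq ones_nseq /= -(ones_zeros w).
move=> /andP[-> H] ou su; rewrite -{1}ou eqxx andbT; apply/and3P; split => /=.
- by lia.
- by rewrite /ok take_size_cat ?size_nseq ?sorted_nseq_true.
by rewrite /bit; case: x {H su fu ou}.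
Qed.

(** A bumping insertion turns [false :: a ++ w] into [a ++ [:: true, false & w]], where [x] is
    [(size a).+1]; its inverse deletes the first factor 10 and prepends a 0. *)
Lemma bij_bit1 (V : nmodType) n k (F : seq bool -> V) :
  \sum_(r <- words n | sb 0 r && (ones r == k))
    \sum_(x <- iota 0 n.+1 | ok r x && bit r x) F (ins r x)
  = \sum_(u <- words n.+1 | sb 0 u && (ones u == k.+1)) F u.
Proof.
rewrite sum_pairs.
pose f (p : seq bool * nat) := ins p.1 p.2.
pose g (u : seq bool) :=
  (false :: take (descent u) u ++ drop (descent u).+2 u, (descent u).+1).
apply: (sum_seq_bij (f := f) (g := g)).
- apply: allpairs_uniq; [exact: words_uniq|exact: iota_uniq|].
  by move=> [? ?] [? ?] _ _.
- exact: words_uniq.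
- move=> [r0 x0] /allpairsP[[r' x'] [Hr Hx [-> ->]]].
  move: Hr Hx; rewrite mem_words mem_iota add0n /= => /eqP sr xn.
  case/andP=> /andP[sbr or] /andP[okx bx]; rewrite ltnS -sr in xn.
  case: x' r' xn bx okx sbr or sr => // x [|[] r] //= xr _.
  rewrite /ok /= => /path_sorted so.
  have [a [w [er ex]]] : exists a w, r = a ++ w /\ size a = x.
    by exists (take x r), (drop x r); rewrite cat_take_drop size_takel.
  rewrite {}er -{}ex take_size_cat // in so xr *; move=> sbr or sr.
  rewrite /f /g /= ins_cons0 descent_cat //; split.
  + by rewrite mem_words -sr /= !size_cat /= !addnS.
  + move: sbr or; rewrite sb_cons andbT !sb_cat !sb_cons.
    rewrite !ones_cons !zeros_cons !ones_cat !ones_cons /= andbT.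
    move=> /andP[sw H] /eqP <-; have lw := sb_count sw; rewrite sw.
    have -> : (0 + (0 + (1 + zeros w)) - (1 + (0 + ones w))
               = 0 + zeros w - ones w)%N by lia.
    by rewrite H /=; lia.
  rewrite take_size_cat // -cat_rcons -cat_rcons drop_size_cat //.
  by rewrite !size_rcons.
move=> u; rewrite mem_words => /eqP su /andP[sbu /eqP ou].
have tu : true \in u by rewrite -has_pred1 has_count -/(ones u) ou.
(* A suffix-ballot word ends in 0, so containing a 1 it has a factor 10. *)
have [a [w [eu sa]]] := descent_split tu (sb_last sbu).
rewrite {}eu in su sbu ou tu *.
have -> : g (a ++ [:: true, false & w]) = (false :: a ++ w, (size a).+1).
  rewrite /g descent_cat // take_size_cat // -cat_rcons -cat_rcons.
  by rewrite drop_size_cat // !size_rcons.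
split; last exact: ins_cons0.
  apply/allpairsP; exists (false :: a ++ w, (size a).+1); split => //.
    by move: su; rewrite mem_words /= !size_cat /= !addnS => -[->].
  by rewrite mem_iota -su size_cat /=; lia.
move: sbu ou; rewrite /= sb_cons !sb_cat !sb_cons !ones_cons !zeros_cons.
rewrite !ones_cat !ones_cons /= !andbT => /andP[/andP[sw _] H] ou.
have lw := sb_count sw; rewrite sw.
have <- : (0 + (0 + (1 + zeros w)) - (1 + (0 + ones w))
           = 0 + zeros w - ones w)%N by lia.
by rewrite H /ok /= take_size_cat //; apply/andP; split; [lia|case: a sa {su tu H ou}].
Qed.

(** * Two evaluations of the sum over all insertion runs *)

Fixpoint runs (n : nat) : seq (seq nat * seq bool * seq bool) :=
  if n is m.+1 then
    [seq (push t.1.1 x, ins t.1.2 x, rcons t.2 (bit t.1.2 x))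
       | t <- runs m, x <- [seq x <- iota 0 m.+1 | ok t.1.2 x]]
  else [:: ([::], [::], [::])].

Lemma runsS n : runs n.+1 =
  [seq (push t.1.1 x, ins t.1.2 x, rcons t.2 (bit t.1.2 x))
     | t <- runs n, x <- [seq x <- iota 0 n.+1 | ok t.1.2 x]].
Proof. by []. Qed.

Lemma sum_runsS (V : nmodType) n (F : seq nat * seq bool * seq bool -> V) :
  \sum_(t <- runs n.+1) F t
  = \sum_(t <- runs n) \sum_(x <- iota 0 n.+1 | ok t.1.2 x)
      F (push t.1.1 x, ins t.1.2 x, rcons t.2 (bit t.1.2 x)).
Proof.
rewrite runsS big_allpairs_dep.
by apply: eq_bigr => t _; rewrite big_filter.
Qed.

Lemma runsP n t : t \in runs n -> run_inv n t.1.1 t.1.2 t.2.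
Proof.
elim: n t => [|n IH] t.
  rewrite inE => /eqP ->; split => //.
  by apply/av123P.
rewrite runsS => /allpairsPdep[t' [x [Ht']]].
rewrite mem_filter mem_iota add0n ltnS => /and3P[okx _ xn] ->.
exact: run_step (IH _ Ht') xn okx.
Qed.

Lemma sum_runs_perm (V : nmodType) n (F : seq nat -> V) :
  \sum_(t <- runs n) F t.1.1
  = \sum_(s : 'S_n | av123 (perm_word s)) F (perm_word s).
Proof.
elim: n F => [|n IH] F.
  rewrite big_seq1 (big_pred1 1%g) => [|s]; last first.
    have -> : s = 1%g by apply/permP => -[].
    by rewrite /= eqxx; apply/av123P => i j k _ _; rewrite size_perm_word.
  by rewrite /perm_word enum_ord0.
rewrite sum_runsS.
transitivity (\sum_(t <- runs n) \sum_(x <- iota 0 n.+1 | av123 (push t.1.1 x))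
                F (push t.1.1 x)).
  apply: eq_big_seq => t /runsP inv; rewrite big_seq_cond [RHS]big_seq_cond.
  apply: eq_bigl => x; rewrite mem_iota add0n ltnS /=.
  by case: leqP => //= xn; rewrite (run_ok inv).
rewrite (IH (fun l => \sum_(x <- iota 0 n.+1 | av123 (push l x)) F (push l x))).
rewrite [RHS]big_mkcond.
rewrite (@sum_perm_lift V n (fun l => if av123 l then F l else 0)).
rewrite [LHS]big_mkcond; apply: eq_bigr => s _; rewrite -big_mkcond.
case: ifP => // nav; rewrite big_pred0 // => x.
by rewrite av123_push nav.
Qed.

(** Every pair of ballot words with equally many 1s arises from exactly one run: the last letter of
    [v] tells which of [bij_bit0] and [bij_bit1] undoes the last insertion. *)
Lemma sum_runs_words (V : nmodType) n (G : seq bool -> seq bool -> V) :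
  \sum_(t <- runs n) G t.1.2 t.2
  = \sum_(v <- words n | pb 0 v)
      \sum_(r <- words n | sb 0 r && (ones r == ones v)) G r v.
Proof.
elim: n G => [|n IH] G; first by rewrite !big_cons !big_nil /= !addr0.
rewrite sum_runsS (IH (fun r v => \sum_(x <- iota 0 n.+1 | ok r x)
                                G (ins r x) (rcons v (bit r x)))).
rewrite [RHS]big_mkcond sum_words_rcons big_mkcond; apply: eq_big_seq => v.
rewrite mem_words => /eqP sv; rewrite !pb_rcons !ones_rcons addn0 addn1.
case: (boolP (pb 0 v)) => //= pv; last by rewrite addr0.
have ov := pb_count pv; have := ones_zeros v; rewrite sv => zv.
have lev : ((ones v).*2 <= n)%N by lia.
rewrite -(bij_bit0 (G^~ (rcons v false)) lev).
transitivity (\sum_(r <- words n | sb 0 r && (ones r == ones v))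
   \sum_(x <- iota 0 n.+1 | ok r x && ~~ bit r x) G (ins r x) (rcons v false)
 + \sum_(r <- words n | sb 0 r && (ones r == ones v))
   \sum_(x <- iota 0 n.+1 | ok r x && bit r x) G (ins r x) (rcons v true)).
  rewrite -big_split; apply: eq_bigr => r _ /=.
  rewrite (bigID (bit r)) /= addrC; congr (_ + _); apply: eq_bigr => x.
    by move=> /andP[_ /negbTE ->].
  by move=> /andP[_ ->].
congr (_ + _); rewrite (bij_bit1 n _ (G^~ (rcons v true))).
(* When 1 may not be appended to [v], no suffix-ballot word has the required number of 1s either. *)
case: ifP => // nlt; rewrite big1_seq // => u /andP[/andP[/sb_count H /eqP ou]].
rewrite mem_words => /eqP su; have := ones_zeros u; rewrite su; lia.
Qed.

(** * Major indices read off the two tableaux *)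

Lemma maj_permE n (s : 'S_n) : maj_perm s =
  (\sum_(1 <= i < n | nth 0 (perm_word s) i < nth 0 (perm_word s) i.-1) i)%N.
Proof.
rewrite /maj_perm big_nat_cond [RHS]big_nat_cond; apply: eq_bigl => i.
case: (boolP (0 < i < n)%N) => //= /andP[i0 ltin].
have e j : (j < n)%N -> nth 0%N (one_line s) j = (nth 0%N (perm_word s) j).+1.
  move=> ltjn; pose J := Ordinal ltjn.
  by rewrite -[j]/(val J) nth_perm_word (nth_map J) ?size_enum_ord // nth_ord_enum.
by rewrite !e ?ltnS //; lia.
Qed.

Lemma index_perm_word n (s : 'S_n) (i : 'I_n) :
  index (i : nat) (perm_word s) = (s^-1)%g i.
Proof.
rewrite -{1}(permKV s i) -(nth_perm_word s) index_uniq ?size_perm_word //.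
rewrite map_inj_uniq ?enum_uniq //.
by apply: inj_comp; [exact: val_inj | exact: perm_inj].
Qed.

Lemma maj_permVE n (s : 'S_n) : maj_perm (s^-1)%g =
  (\sum_(1 <= i < n | index i (perm_word s) < index i.-1 (perm_word s)) i)%N.
Proof.
rewrite maj_permE big_nat_cond [RHS]big_nat_cond; apply: eq_bigl => i.
case: (boolP (0 < i < n)%N) => //= /andP[i0 ltin].
have e j : (j < n)%N -> nth 0%N (perm_word (s^-1)%g) j = index j (perm_word s).
  move=> ltjn; pose J := Ordinal ltjn.
  by rewrite -[j]/(nat_of_ord J) nth_perm_word index_perm_word.
by rewrite !e //; lia.
Qed.

(** Every position is a descent or an ascent of [l], and the ascents are the descents of the
    complement of [v]. *)
Lemma run_maj n l r v : run_inv n l r v ->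
  (\sum_(1 <= i < n | nth 0 l i < nth 0 l i.-1) i + maj_word (map negb v)
   = \sum_(1 <= i < n) i)%N.
Proof.
case=> sl ul _ _ sv _ _ Hd _.
rewrite [RHS](bigID (fun i => nth 0%N l i < nth 0%N l i.-1)%N) /=.
congr (_ + _)%N; rewrite /maj_word size_map sv big_nat_cond [RHS]big_nat_cond.
apply: eq_bigl => i; case: (boolP (0 < i < n)%N) => //= /andP[i0 ltin].
have [j ej] : {j | i = j.+1} by exists i.-1; lia.
rewrite ej in ltin *; rewrite /= !(nth_map false) ?sv // ?(ltnW ltin) // negbK.
by rewrite -Hd // -leqNgt [RHS]leq_eqVlt nth_uniq ?sl ?(ltnW ltin) // ltn_eqF.
Qed.

Lemma run_majV n l r v : run_inv n l r v ->
  (\sum_(1 <= i < n | index i l < index i.-1 l) i + maj_word r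
   = \sum_(1 <= i < n) i)%N.
Proof.
case=> sl ul ml sr _ _ Hi _ _.
rewrite [RHS](bigID (fun i => index i l < index i.-1 l)%N) /=.
congr (_ + _)%N; rewrite /maj_word sr big_nat_cond [RHS]big_nat_cond.
apply: eq_bigl => i; case: (boolP (0 < i < n)%N) => //= /andP[i0 ltin].
have [j ej] : {j | i = j.+1} by exists i.-1; lia.
rewrite ej in ltin *; rewrite /= -Hi // -leqNgt [RHS]leq_eqVlt.
have [e|//] := eqVneq (index j l) (index j.+1 l).
have : nth 0%N l (index j l) = nth 0%N l (index j.+1 l) by rewrite e.
by rewrite !nth_index ?ml ?(ltnW ltin) //; lia.
Qed.

Lemma sum_av123 (V : nmodType) n (F : nat -> nat -> V) :
  (forall a b k, F (a + k)%N (b + k)%N = F a b) ->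
  \sum_(s : 'S_n | avoids123 s) F (maj_perm s) (maj_perm (s^-1)%g)
  = \sum_(r <- words n | sb 0 r)
      \sum_(v <- words n | pb 0 v && (ones v == ones r))
        F (maj_word r) (maj_word (map negb v)).
Proof.
move=> HF.
pose G l := F (\sum_(1 <= i < n | nth 0 l i < nth 0 l i.-1) i)%N
              (\sum_(1 <= i < n | index i l < index i.-1 l) i)%N.
transitivity (\sum_(s : 'S_n | av123 (perm_word s)) G (perm_word s)).
  apply: eq_big => s; first exact: avoids123E.
  by rewrite maj_permE maj_permVE.
rewrite -sum_runs_perm.
transitivity (\sum_(t <- runs n) F (maj_word t.1.2) (maj_word (map negb t.2))).
  apply: eq_big_seq => t /runsP inv; rewrite /G.
  (* [run_maj] and [run_majV] have the same right-hand side, so the two major indices differ exactly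
     as those of [r] and of the complement of [v]. *)
  rewrite -(HF _ _ (maj_word (map negb t.2))) (run_maj inv) -(run_majV inv).
  by rewrite addnC [X in F _ X]addnC HF.
rewrite (@sum_runs_words V n (fun r v => F (maj_word r) (maj_word (map negb v)))).
rewrite (exchange_big_dep (sb 0)) /= => [|v r _ /andP[]//].
apply: eq_bigr => r sbr; apply: eq_bigl => v.
by rewrite sbr /= eq_sym.
Qed.

Theorem theorem1 (R : comUnitRingType) (q : R) (hq : q \is a GRing.unit)
    (n : nat) (hn : (0 < n)%N) :
  \sum_(w : (n.*2).-tuple bool | is_catalan n w)
      q ^ ((maj_word w)%:Z - (maj_word (word_inv w))%:Z)
  = \sum_(s : 'S_n | avoids123 s)
      q ^ (2 * ((maj_perm s)%:Z - (maj_perm (s^-1)%g)%:Z)).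
Proof.
(* With the first word fixed, the factor in [a] leaves the inner sum, which becomes a generating
   function at [q^-1 ^+ 2], to which [sum_sb_pb] applies. *)
have E (a b : nat) :
    q ^ (2 * (a%:Z - b%:Z)) = (q ^+ 2) ^+ a * (q^-1 ^+ 2) ^+ b.
  rewrite -exprz_exp; have -> : q ^ 2 = q ^+ 2 by [].
  by rewrite exprzDr ?unitrX // -exprz_inv exprVn.
rewrite (@sum_catalan _ n (fun a b => q ^ (a%:Z - b%:Z))); last first.
  by move=> a b k; congr (q ^ _); lia.
rewrite (@sum_av123 _ n (fun a b => q ^ (2 * (a%:Z - b%:Z)))); last first.
  by move=> a b k; congr (q ^ _); lia.
rewrite big_seq_cond [RHS]big_seq_cond; apply: eq_bigr => r /andP[].
rewrite mem_words => /eqP sr sbr.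
under eq_bigr do rewrite !PoszM -mulrBr E.
under [RHS]eq_bigr do rewrite E.
rewrite -!big_distrr /= sum_sb_pb //.
have := sb_count sbr; have := ones_zeros r; rewrite sr; lia.
Qed.
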